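(* There exists an absolute constant $c>0$ such that the following holds. Let $N \geq 1+\exp(e^e)$ be an integer and let $A,B,C$ be nonempty subsets of $\mathbb{Z}/N\mathbb{Z}$ of respective densities $\alpha=|A|/N$, $\beta=|B|/N$, $\gamma=|C|/N$. If $$\alpha\,\Big(\log \tfrac{2}{\alpha\beta\gamma}\Big)^{-5/2} \geq (c\log N)^{-1/2},$$ then $A+B+C$ contains an arithmetic progression of length at least $$N^{\,c\,\alpha^2/\log^4(2/\alpha\beta\gamma)}$$ such that each element of the progression has at least $\tfrac12\alpha\beta\gamma N^2$ representations as a sum $x+y+z$ with $(x,y,z)\in A\times B\times C$.
   Context: All logarithms are natural logarithms. *)

(* Defs.v *)
From HB Require Import structures.
From mathcomp Require Import all_boot all_order all_algebra.
From Stdlib Require Import Reals.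
Set Implicit Arguments. Unset Strict Implicit. Unset Printing Implicit Defensive.
Import GRing.Theory.

Section ZN.
Local Open Scope ring_scope.

Definition rep_count (N : nat) (A B C : {set 'Z_N}) (w : 'Z_N) : nat :=
  #|[set t : 'Z_N * 'Z_N * 'Z_N |
      [&& t.1.1 \in A, t.1.2 \in B, t.2 \in C & (t.1.1 + t.1.2 + t.2 == w)]]|.

Definition sumset3 (N : nat) (A B C : {set 'Z_N}) : {set 'Z_N} :=
  [set w : 'Z_N | [exists x in A, exists y in B, exists z in C, (x + y + z == w)]].

Definition ap_term (N : nat) (a d : 'Z_N) (i : nat) : 'Z_N := a + d *+ i.

End ZN.

Local Open Scope R_scope.
Definition dens (N : nat) (A : {set 'Z_N}) : R := INR #|A| / INR N.

(* Main.v *)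
(* Write F(w) for the proportion of pairs (b,c) in B x C with w - b - c in A;
   its mean is alpha, so F(w0) >= alpha for some w0, and it suffices to find a
   long progression of translations along which F moves by at most alpha/2.

   Croot-Sisask sampling: averaging 1_A over k random translates by elements of
   B approximates 1_A * mu_B so well that, after convolving with C, the error is
   uniformly at most e once k ~ log(1/gamma)/e^2. By pigeonhole some k-tuple
   serves for a set T of shifts of density at least beta^k/2, and F is
   2e-invariant under T - T. Hence F is close to its l-fold smoothing over
   T - T, with l ~ log(2/alpha beta gamma) and e ~ alpha/l, whose Fourier
   transform is negligible off the large spectrum of T.

   By Chang's theorem that spectrum lies in the {-1,0,1}-span of
   d << log(1/density of T) << log^4(2/alpha beta gamma)/alpha^2 characters.
   Dirichlet's pigeonhole principle gives a step t at which all of them are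
   nearly 1, and the multiples of t form the progression. *)

From Stdlib Require Import Reals Lra Psatz ZArith.

(** * Choice of the numerical parameters *)

Section Numerics.
Local Open Scope R_scope.

Lemma exists_nat_ceil (x : R) : 0 <= x -> exists n : nat, x <= INR n <= x + 1.
Proof.
intros hx. destruct (archimed x) as [h1 h2].
assert (0 <= up x)%Z by (apply le_IZR; lra).
exists (Z.to_nat (up x)). rewrite INR_IZR_INZ, Z2Nat.id by assumption. lra.
Qed.

Lemma two_le_exp1 : 2 <= exp 1.
Proof. pose proof (exp_ineq1_le 1). lra. Qed.

Lemma exp_mult_INR (x : R) (n : nat) : exp (INR n * x) = exp x ^ n.
Proof.
induction n as [|n IH]; [simpl; rewrite Rmult_0_l; exact exp_0|].
rewrite S_INR, Rmult_plus_distr_r, Rmult_1_l, exp_plus, IH. simpl. ring.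
Qed.

Lemma pow2_le_exp (n : nat) : 2 ^ n <= exp (INR n).
Proof.
rewrite <- (Rmult_1_r (INR n)), exp_mult_INR.
apply pow_incr. pose proof two_le_exp1. lra.
Qed.

Lemma exp_le_mono (x y : R) : x <= y -> exp x <= exp y.
Proof.
intros [h|h]; [left; apply exp_increasing; exact h|rewrite h; lra].
Qed.

Lemma product_of_densities (x y z n : R) : n <> 0 ->
  / 2 * (x / n * (y / n) * (z / n)) * n ^ 2 = x * y * z / n / INR 2.
Proof. intros hn. simpl. field. exact hn. Qed.

Section Densities.
Variables a b g n : R.
Hypotheses (a0 : 0 < a) (a1 : a <= 1) (b0 : 0 < b) (b1 : b <= 1)
  (g0 : 0 < g) (g1 : g <= 1) (n1 : 1 < n).
Let K := ln (2 / (a * b * g)).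

Lemma expK : exp K = 2 / (a * b * g).
Proof.
apply exp_ln. apply Rdiv_lt_0_compat; [lra|].
repeat apply Rmult_lt_0_compat; assumption.
Qed.

Lemma abg_le : a * b * g <= a /\ a * b * g <= a * b /\ a * b * g <= b /\
  a * b * g <= g /\ 0 < a * b * g.
Proof.
assert (h1 : 0 < a * b) by (apply Rmult_lt_0_compat; assumption).
assert (h2 : 0 < a * b * g) by (apply Rmult_lt_0_compat; assumption).
assert (h3 : a * b <= 1) by nra.
assert (h4 : a * b <= a) by nra.
assert (h5 : a * b <= b) by nra.
assert (h6 : a * b * g <= a * b) by nra.
assert (h7 : a * b * g <= g) by nra.
repeat split; lra.
Qed.

(** Trades inverse densities for [exp K]: each of [a], [b], [g] and [a * b] is at least
    [a * b * g]. *)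
Lemma inv_le_expK (x : R) : a * b * g <= x -> 2 * / x <= exp K.
Proof.
intros hx. destruct abg_le as (_ & _ & _ & _ & h). rewrite expK. unfold Rdiv.
apply Rmult_le_compat_l; [lra|]. apply Rinv_le_contravar; assumption.
Qed.

(** [exp K] is at least 2, while [exp (/ 2)] squares to at most 3. The bound lets numerical
    constants be absorbed into powers of [K]. *)
Lemma K_ge : / 2 <= K.
Proof.
assert (h : 2 <= exp K).
{ replace 2 with (2 * / 1) by field. apply inv_le_expK. destruct abg_le. lra. }
destruct (Rle_lt_dec (/ 2) K) as [hk|hk]; [exact hk|exfalso].
apply exp_increasing in hk.
assert (he : exp (/ 2) * exp (/ 2) <= 3).
{ rewrite <- exp_plus. replace (/ 2 + / 2) with 1 by field. exact exp_le_3. }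
nra.
Qed.

Lemma two_pow_le_expK (m : nat) : 2 ^ m <= exp (2 * INR m * K).
Proof.
eapply Rle_trans; [apply pow2_le_exp|]. apply exp_le_mono.
pose proof K_ge. pose proof (pos_INR m). nra.
Qed.

(** Squaring clears the half-integer exponents and leaves the form in which the density hypothesis
    is used. *)
Lemma hypothesis_squared (c : R) : 0 < c ->
  a * Rpower K (- (5 / 2)) >= Rpower (c * ln n) (- (1 / 2)) ->
  K ^ 5 <= a ^ 2 * (c * ln n).
Proof.
intros c0 h. pose proof K_ge as hK.
assert (X0 : 0 < c * ln n).
{ apply Rmult_lt_0_compat; [exact c0|]. rewrite <- ln_1. apply ln_increasing; lra. }
set (u := Rpower K (- (5 / 2))) in *. set (v := Rpower (c * ln n) (- (1 / 2))) in *.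
assert (hu : u * u * K ^ 5 = 1).
{ unfold u. rewrite <- Rpower_plus, <- (Rpower_pow 5) by lra. rewrite <- Rpower_plus.
  replace (- (5 / 2) + - (5 / 2) + INR 5) with 0 by (simpl; field).
  apply Rpower_O. lra. }
assert (hv : v * v * (c * ln n) = 1).
{ unfold v. rewrite <- Rpower_plus.
  rewrite <- (Rpower_1 (c * ln n)) at 2 by exact X0. rewrite <- Rpower_plus.
  replace (- (1 / 2) + - (1 / 2) + 1) with 0 by field. apply Rpower_O. exact X0. }
assert (u0 : 0 < u) by apply exp_pos. assert (v0 : 0 < v) by apply exp_pos.
assert (h2 : v * v <= a * u * (a * u)) by nra.
assert (K5 : 0 < K ^ 5) by (apply pow_lt; lra).
assert (h3 : v * v * (c * ln n) * K ^ 5 <= a * u * (a * u) * (c * ln n) * K ^ 5).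
{ apply Rmult_le_compat_r; [lra|]. apply Rmult_le_compat_r; lra. }
replace (a * u * (a * u) * (c * ln n) * K ^ 5)
  with ((u * u * K ^ 5) * (a ^ 2 * (c * ln n))) in h3 by ring.
rewrite hu, hv in h3. lra.
Qed.

(** [k] counts sampled translates, [l] smoothings, [e] is the sampling error and [D] bounds the
    dimension of the spectrum. Since [e ~ a / K], [k ~ K / e ^ 2] and [D ~ K * k], the size of [D]
    is [K ^ 4 / a ^ 2]. *)
Lemma parameters_kD : exists (k l D : nat) (e : R),
  (0 < k)%nat /\ 1 <= INR D /\ 0 < e <= 2 /\
  4 / g <= exp (INR k * e ^ 2 / 8) /\
  2 * (/ b) ^ k <= exp (INR D / 32) /\
  INR l * e * 16 <= a /\
  / b * (2 * (1 / 4) ^ l) * 4 <= a / 2 /\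
  INR D * a ^ 2 <= 17000000 * K ^ 4.
Proof.
pose proof K_ge as hK.
(* 7 = 6 + 1: [exp (6 * K)] covers a factor 8 and [exp K] covers [2 / (a * b)], whence
   [4 ^ l >= 16 / (a * b)]. *)
destruct (exists_nat_ceil (7 * K)) as [l [l1 l2]]; [lra|].
assert (l0 : 0 < INR l) by lra.
set (e := a / (16 * INR l)).
assert (e0 : 0 < e) by (apply Rdiv_lt_0_compat; lra).
assert (hle : INR l * e * 16 = a) by (unfold e; field; lra).
assert (e2 : 0 < e ^ 2) by (apply pow_lt; exact e0).
(* Makes [k * e ^ 2 / 8 >= 3 * K]: one [K] pays for [2 / g], the other two for the remaining factor
   2. *)
destruct (exists_nat_ceil (24 * K / e ^ 2)) as [k [k1 k2]].
{ apply Rlt_le, Rdiv_lt_0_compat; lra. }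
assert (k0 : 0 < INR k).
{ eapply Rlt_le_trans; [|exact k1]. apply Rdiv_lt_0_compat; lra. }
(* [k * K] pays for the k-th power of [/ b], and [2 * K] for the factor 2. *)
destruct (exists_nat_ceil (32 * (K * (INR k + 2)))) as [D [D1 D2]]; [nra|].
assert (le9 : INR l <= 9 * K) by lra.
assert (a2 : 0 < a ^ 2) by (apply pow_lt; exact a0).
assert (a21 : a ^ 2 <= 1) by nra.
assert (K2 : / 4 <= K ^ 2) by nra.
assert (K3 : / 8 <= K ^ 3) by (replace (K ^ 3) with (K ^ 2 * K) by ring; nra).
assert (K4 : / 16 <= K ^ 4) by (replace (K ^ 4) with (K ^ 3 * K) by ring; nra).
exists k, l, D, e. repeat split.
- apply INR_lt. exact k0.
- nra.
- exact e0.
- nra.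
- apply Rle_trans with (exp (3 * K)).
  + replace (3 * K) with (K + 2 * INR 1 * K) by (simpl; ring). rewrite exp_plus.
    replace (4 / g) with (2 * / g * 2) by (field; lra).
    apply Rmult_le_compat; [|lra| |].
    * apply Rmult_le_pos; [lra|]. apply Rlt_le, Rinv_0_lt_compat; exact g0.
    * apply inv_le_expK. apply abg_le.
    * replace 2 with (2 ^ 1) at 1 by ring. apply two_pow_le_expK.
  + apply exp_le_mono.
    assert (h : 24 * K <= INR k * e ^ 2).
    { replace (24 * K) with (24 * K / e ^ 2 * e ^ 2) by (field; lra).
      apply Rmult_le_compat_r; lra. }
    lra.
- assert (hb : / b <= exp K).
  { assert (h : 2 * / b <= exp K) by (apply inv_le_expK; apply abg_le).
    pose proof (Rinv_0_lt_compat _ b0). lra. }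
  apply Rle_trans with (exp (2 * INR 1 * K) * exp (INR k * K)).
  + apply Rmult_le_compat; [lra| | |].
    * apply pow_le. apply Rlt_le, Rinv_0_lt_compat; exact b0.
    * replace 2 with (2 ^ 1) at 1 by ring. apply two_pow_le_expK.
    * rewrite exp_mult_INR. apply pow_incr. split; [|exact hb].
      apply Rlt_le, Rinv_0_lt_compat; exact b0.
  + rewrite <- exp_plus. apply exp_le_mono. simpl. lra.
- lra.
- assert (h1 : 16 * / (a * b) <= 4 ^ l).
  { apply Rle_trans with (exp (INR l)).
    - apply Rle_trans with (exp (7 * K)); [|apply exp_le_mono; exact l1].
      replace (7 * K) with (2 * INR 3 * K + K) by (simpl; ring). rewrite exp_plus.
      replace (16 * / (a * b)) with (2 ^ 3 * (2 * / (a * b))) by (field; lra).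
      apply Rmult_le_compat; [lra| |apply two_pow_le_expK|apply inv_le_expK; apply abg_le].
      apply Rmult_le_pos; [lra|]. apply Rlt_le, Rinv_0_lt_compat.
      apply Rmult_lt_0_compat; assumption.
    - rewrite <- (Rmult_1_r (INR l)), exp_mult_INR. apply pow_incr.
      pose proof exp_le_3. pose proof (exp_pos 1). lra. }
  assert (p4 : 0 < 4 ^ l) by (apply pow_lt; lra).
  assert (h2 : (1 / 4) ^ l = / 4 ^ l).
  { unfold Rdiv. rewrite Rmult_1_l, pow_inv. reflexivity. }
  rewrite h2.
  apply Rmult_le_reg_l with (2 * b * 4 ^ l); [nra|].
  replace (2 * b * 4 ^ l * (/ b * (2 * / 4 ^ l) * 4)) with 16 by (field; lra).
  replace (2 * b * 4 ^ l * (a / 2)) with (a * b * 4 ^ l) by field.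
  replace 16 with (a * b * (16 * / (a * b))) by (field; lra).
  apply Rmult_le_compat_l; [nra|exact h1].
(* With [e = a / (16 l)] and [l <= 9 K] the leading constant is 24 * 256 * 81 = 497664. Then 32 *
   500000 leaves a million [K ^ 4] for the lower-order terms. *)
- assert (hk : INR k * a ^ 2 <= 500000 * K ^ 3).
  { assert (h : 24 * K / e ^ 2 * a ^ 2 = 6144 * K * INR l ^ 2).
    { unfold e. field. lra. }
    assert (h' : INR l ^ 2 <= 81 * K ^ 2) by nra.
    assert (h'' : 6144 * K * INR l ^ 2 <= 6144 * K * (81 * K ^ 2)).
    { apply Rmult_le_compat_l; lra. }
    replace (6144 * K * (81 * K ^ 2)) with (497664 * K ^ 3) in h'' by ring.
    assert (INR k * a ^ 2 <= (24 * K / e ^ 2 + 1) * a ^ 2) by (apply Rmult_le_compat_r; lra).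
    lra. }
  assert (h1 : INR D * a ^ 2 <= (32 * (K * (INR k + 2)) + 1) * a ^ 2)
    by (apply Rmult_le_compat_r; lra).
  replace ((32 * (K * (INR k + 2)) + 1) * a ^ 2)
    with (32 * (K * (INR k * a ^ 2)) + (64 * K + 1) * a ^ 2) in h1 by ring.
  assert (h2 : K * (INR k * a ^ 2) <= K * (500000 * K ^ 3)) by (apply Rmult_le_compat_l; lra).
  replace (K * (500000 * K ^ 3)) with (500000 * K ^ 4) in h2 by ring.
  assert (h3 : (64 * K + 1) * a ^ 2 <= 64 * K + 1) by nra.
  assert (h4 : K <= 8 * K ^ 4).
  { replace (K ^ 4) with (K * K ^ 3) by ring. nra. }
  lra.
Qed.

Lemma ln_le_self (x : R) : 0 < x -> ln x <= x.
Proof.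
intros hx. pose proof (exp_ineq1_le (ln x)) as h. rewrite exp_ln in h by exact hx. lra.
Qed.

(* With t = c a^2 / K^4, the logarithm is at most 3 D t ln n + 140 D K, and both
   D t ln n and D K are at most 17000000 c ln n; 143 * 17000000 = 2431000000. *)
Lemma log_count_bound (c D L M : R) : c = / 2431000000 ->
  K ^ 5 <= a ^ 2 * (c * ln n) -> 1 <= D -> D * a ^ 2 <= 17000000 * K ^ 4 ->
  1 <= L -> L <= 2 * Rpower n (c * a ^ 2 / K ^ 4) ->
  0 < M -> M <= 18 * (D * L * exp K) ->
  ln L + 2 * D * ln M <= ln n.
Proof.
intros hc hX D1 hD L1 hL M0 hM. pose proof K_ge as hK.
set (t := c * a ^ 2 / K ^ 4) in *.
assert (ln_le : forall x y, 0 < x -> x <= y -> ln x <= ln y).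
{ intros x y hx [h|h]; [left; apply ln_increasing; assumption|rewrite h; lra]. }
assert (ln2 : ln 2 <= 1).
{ rewrite <- (ln_exp 1). apply ln_le; [lra|exact two_le_exp1]. }
assert (a2 : 0 < a ^ 2) by (apply pow_lt; exact a0).
assert (K4 : 0 < K ^ 4) by (apply pow_lt; lra).
assert (X0 : 0 < ln n) by (rewrite <- ln_1; apply ln_increasing; lra).
assert (lnL : ln L <= 1 + t * ln n).
{ apply Rle_trans with (ln (2 * Rpower n t)); [apply ln_le; lra|].
  rewrite ln_mult by (try apply exp_pos; lra). unfold Rpower. rewrite ln_exp. lra. }
assert (lnL0 : 0 <= ln L) by (rewrite <- ln_1; apply ln_le; lra).
assert (lna : - ln a <= K).
{ assert (h : 2 * / a <= exp K) by (apply inv_le_expK; apply abg_le).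
  pose proof (Rinv_0_lt_compat _ a0) as ha.
  rewrite <- ln_Rinv by exact a0. rewrite <- (ln_exp K). apply ln_le; lra. }
(* 17000000 is below [2 ^ 25]; [4 * ln K] costs [4 * K] and [- 2 * ln a] costs [2 * K]. *)
assert (lnD : ln D <= 25 + 6 * K).
{ assert (h : ln (D * a ^ 2) <= ln (2 ^ 25 * K ^ 4)).
  { apply ln_le; [apply Rmult_lt_0_compat; lra|].
    eapply Rle_trans; [exact hD|]. apply Rmult_le_compat_r; lra. }
  rewrite !ln_mult in h by (try apply pow_lt; lra).
  rewrite !ln_pow in h by lra.
  pose proof (ln_le_self K ltac:(lra)).
  replace (INR 25) with 25 in h by (simpl; ring).
  replace (INR 4) with 4 in h by (simpl; ring).
  replace (INR 2) with 2 in h by (simpl; ring). lra. }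
assert (E0 : 0 < exp K) by apply exp_pos.
assert (lnM : ln M <= 30 + 7 * K + ln L).
{ apply Rle_trans with (ln (2 ^ 5 * (D * L * exp K))).
  - apply ln_le; [exact M0|].
    assert (0 < D * L * exp K) by (repeat apply Rmult_lt_0_compat; lra). lra.
  - assert (0 < D * L) by (apply Rmult_lt_0_compat; lra).
    rewrite !ln_mult by (try apply Rmult_lt_0_compat; lra).
    rewrite ln_pow, ln_exp by lra. replace (INR 5) with 5 by (simpl; ring). lra. }
assert (s1 : ln L + 2 * D * ln M <= 3 * D * (t * ln n) + 140 * (D * K)).
{ assert (2 * D * ln M <= 2 * D * (30 + 7 * K + ln L)) by (apply Rmult_le_compat_l; lra).
  assert (ln L <= D * ln L) by nra.
  assert (3 * D * ln L <= 3 * D * (1 + t * ln n)) by (apply Rmult_le_compat_l; lra).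
  assert (D <= 2 * (D * K)) by nra. lra. }
assert (s2 : D * (t * ln n) <= 17000000 * (c * ln n)).
{ replace (D * (t * ln n)) with (D * a ^ 2 * (c * ln n * / K ^ 4)) by (unfold t; field; lra).
  assert (0 < c * ln n * / K ^ 4).
  { apply Rmult_lt_0_compat; [|apply Rinv_0_lt_compat; exact K4]. rewrite hc. lra. }
  apply Rle_trans with (17000000 * K ^ 4 * (c * ln n * / K ^ 4)).
  - apply Rmult_le_compat_r; lra.
  - right. field. lra. }
(* The density hypothesis enters here, through [K ^ 5]. *)
assert (s3 : D * K <= 17000000 * (c * ln n)).
{ apply Rmult_le_reg_l with (a ^ 2); [exact a2|].
  assert (D * a ^ 2 * K <= 17000000 * K ^ 4 * K) by (apply Rmult_le_compat_r; lra).
  replace (K ^ 5) with (K ^ 4 * K) in hX by ring. lra. }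
rewrite hc in s2, s3. lra.
Qed.

(** Adds the length [L] of the progression and the resolution [M] of the pigeonhole argument. The
    bound on [L * (M + 1) ^ (2 D)] will keep the progression from wrapping around. *)
Lemma parameters (c : R) : c = / 2431000000 ->
  a * Rpower K (- (5 / 2)) >= Rpower (c * ln n) (- (1 / 2)) ->
  exists (k l M L D : nat) (e : R),
  (0 < k)%nat /\ 0 < e <= 2 /\ (0 < M)%nat /\
  4 / g <= exp (INR k * e ^ 2 / 8) /\
  2 * (/ b) ^ k <= exp (INR D / 32) /\
  INR l * e * 16 <= a /\
  / b * (INR D * (INR L * (4 / INR M)) + 2 * (1 / 4) ^ l) * 4 <= a /\
  INR L * INR (S M) ^ (2 * D) <= n /\
  Rpower n (c * a ^ 2 / K ^ 4) <= INR L.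
Proof.
intros hc hyp. pose proof K_ge as hK.
apply hypothesis_squared in hyp; [|rewrite hc; lra].
destruct parameters_kD as (k & l & D & e & k0 & D1 & he & h1 & h2 & h3 & h4 & hD).
set (t := c * a ^ 2 / K ^ 4) in *.
assert (t0 : 0 <= t).
{ apply Rmult_le_pos; [apply Rmult_le_pos; [rewrite hc; lra|apply pow_le; lra]|].
  apply Rlt_le, Rinv_0_lt_compat, pow_lt. lra. }
assert (p1 : 1 <= Rpower n t).
{ rewrite <- (Rpower_O n) by lra. apply Rle_Rpower; lra. }
destruct (exists_nat_ceil (Rpower n t)) as [L [L1 L2]]; [lra|].
assert (E1 : 1 <= exp K) by (pose proof (exp_ineq1_le K); lra).
assert (P1 : 1 <= INR D * INR L) by nra.
assert (P2 : 1 <= INR D * INR L * exp K) by nra.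
(* The translation error [16 D L / (b M)] is at most [a / 2] once [M >= 16 D L * (2 / (a b))]. *)
destruct (exists_nat_ceil (16 * (INR D * INR L * exp K))) as [M [M1 M2]]; [lra|].
assert (M0 : 0 < INR M) by lra.
exists k, l, M, L, D, e.
split; [exact k0|]. split; [exact he|]. split; [apply INR_lt; exact M0|].
split; [exact h1|]. split; [exact h2|]. split; [exact h3|]. split; [|split; [|exact L1]].
- assert (hb : 2 * / (a * b) <= exp K) by (apply inv_le_expK; apply abg_le).
  assert (h5 : / b * (INR D * (INR L * (4 / INR M))) * 4 <= a / 2).
  { apply Rmult_le_reg_l with (INR M * / a); 
      [apply Rmult_lt_0_compat; [lra|apply Rinv_0_lt_compat; lra]|].
    replace (INR M * / a * (/ b * (INR D * (INR L * (4 / INR M))) * 4))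
      with (8 * (INR D * INR L * (2 * / (a * b)))) by (field; lra).
    replace (INR M * / a * (a / 2)) with (INR M / 2) by (field; lra).
    assert (INR D * INR L * (2 * / (a * b)) <= INR D * INR L * exp K)
      by (apply Rmult_le_compat_l; lra).
    lra. }
  lra.
- assert (S0 : 0 < INR (S M)) by (rewrite S_INR; lra).
  assert (hl : ln (INR L) + 2 * INR D * ln (INR (S M)) <= ln n).
  { apply (log_count_bound c); try assumption; fold t; try lra.
    rewrite S_INR. lra. }
  rewrite <- (exp_ln (INR L)) at 1 by lra.
  rewrite <- Rpower_pow by exact S0. unfold Rpower. rewrite <- exp_plus, mult_INR.
  replace (INR 2) with 2 by (simpl; ring).
  apply Rle_trans with (exp (ln n)); [apply exp_le_mono; lra|].
  rewrite exp_ln; lra.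
Qed.
End Densities.
End Numerics.

Require Import Defs.
From HB Require Import structures.
From mathcomp Require Import all_boot all_order all_algebra all_solvable separable cyclotomic.
From Stdlib Require Import Reals.
From mathcomp Require Import Rstruct complex ring lra zify.
Import Order.TTheory GRing.Theory Num.Theory.
Set Implicit Arguments. Unset Strict Implicit. Unset Printing Implicit Defensive.

(* [Reals] reads arguments of type [R], and those of [exp], in [R_scope]. *)
Bind Scope ring_scope with R.
Arguments exp _%_ring_scope.
Local Open Scope complex_scope.
Local Open Scope ring_scope.

(** * Almost periods by random sampling *)

Lemma exp_ge1D (x : R) : 1 + x <= exp x.
Proof. by apply/RleP; exact: exp_ineq1_le. Qed.

Lemma exp_gt0 (x : R) : 0 < exp x.
Proof. by apply/RltP; exact: exp_pos. Qed.

Lemma expD (x y : R) : exp (x + y) = exp x * exp y.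
Proof. by rewrite [RHS]expRD. Qed.

Lemma ler_exp (x y : R) : (exp x <= exp y) = (x <= y).
Proof.
apply/idP/idP => [/RleP h|].
  rewrite leNgt; apply/negP => /RltP /exp_increasing h'.
  exact: (Rlt_not_le _ _ h' h).
rewrite le_eqVlt => /orP[/eqP -> //|/RltP /exp_increasing h].
by apply/RleP; left.
Qed.

(** [exp (- u) >= 1 - u] gives [exp u <= 1 / (1 - u)], and the quadratic times [1 - u] exceeds 1 by
    [u ^ 2 * (1 - 2 u)]. *)
Lemma exp_le_quadratic (u : R) : u <= 1 / 2 -> exp u <= 1 + u + 2 * u ^+ 2.
Proof.
move=> hu; have h1 := exp_ge1D (- u); have h0 := exp_gt0 u.
have hE : exp u * exp (- u) = 1 by rewrite -expD subrr expR0.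
have h2 : exp u * (1 - u) <= 1 by rewrite -[leRHS]hE ler_pM2l.
have h3 : 1 <= (1 + u + 2 * u ^+ 2) * (1 - u).
  rewrite -subr_ge0.
  have -> : (1 + u + 2 * u ^+ 2) * (1 - u) - 1 = u ^+ 2 * (1 - 2 * u) by ring.
  by apply: mulr_ge0; [exact: sqr_ge0 | lra].
have h4 : 0 < 1 - u by lra.
by rewrite -(ler_pM2r h4) (le_trans h2 h3).
Qed.

Lemma exp_sum (I : Type) (r : seq I) (P : pred I) (v : I -> R) :
  exp (\sum_(i <- r | P i) v i) = \prod_(i <- r | P i) exp (v i).
Proof. by rewrite (big_morph exp expD expR0). Qed.

(** Tangent line of [exp] at the mean: the deviations from the mean sum to zero. *)
Lemma exp_jensen (I : finType) (C : {set I}) (v : I -> R) : C != set0 ->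
  #|C|%:R * exp ((\sum_(c in C) v c) / #|C|%:R) <= \sum_(c in C) exp (v c).
Proof.
move=> C0; set m := _ / _.
have nC : (#|C|%:R : R) != 0 by rewrite pnatr_eq0 cards_eq0.
have -> : #|C|%:R * exp m = \sum_(c in C) exp m * (1 + (v c - m)).
  rewrite -mulr_sumr big_split /= sumrB !sumr_const.
  by rewrite -(mulr_natl m) {2}/m mulrC mulrCA divff // mulr1 subrr addr0.
apply: ler_sum => c _.
have {2}-> : v c = m + (v c - m) by ring.
by rewrite expD ler_pM2l ?exp_gt0 // exp_ge1D.
Qed.

Section AlmostPeriods.
Variables (G : finZmodType).
Implicit Types (A B C T : {set G}) (w x t : G).

(** In usual notation [1_A * mu_B] and [1_A * mu_B * mu_C]; the latter is the function F of the
    overview. *)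
Definition conv2 A B x : R := (\sum_(b in B) (x - b \in A)%:R) / #|B|%:R.
Definition conv3 A B C w : R := (\sum_(c in C) conv2 A B (w - c)) / #|C|%:R.

(** The deviations lie in [-1, 1] and sum to zero over [B], so the linear term of [exp_le_quadratic]
    drops out. *)
Lemma exp_moment A B x (u : R) : B != set0 -> `|u| <= 1 / 2 ->
  \sum_(b in B) exp (u * ((x - b \in A)%:R - conv2 A B x)) <=
  #|B|%:R * exp (2 * u ^+ 2).
Proof.
move=> B0 hu; set g := conv2 A B x.
have nB : (#|B|%:R : R) != 0 by rewrite pnatr_eq0 cards_eq0.
have g01 : 0 <= g <= 1.
  rewrite /g /conv2 divr_ge0 ?ler0n ?sumr_ge0 //=.
  rewrite ler_pdivrMr ?lt0r ?nB ?ler0n // mul1r -sumr_const.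
  by apply: ler_sum => b _; case: (_ \in A); rewrite ?ler01.
have hs : \sum_(b in B) ((x - b \in A)%:R - g) = 0 :> R.
  by rewrite sumrB sumr_const -mulr_natl /g /conv2 mulrC divfK // subrr.
apply: (@le_trans _ _ (\sum_(b in B) (1 + u * ((x - b \in A)%:R - g) + 2 * u ^+ 2))).
  apply: ler_sum => b _; set y := _ - g.
  have hy : `|y| <= 1.
    by rewrite /y ler_norml; case: (_ \in A) => /=; case/andP: g01 => *; lra.
  have huy : `|u * y| <= 1 / 2.
    by rewrite normrM -[1 / 2]mulr1 ler_pM.
  have := exp_le_quadratic (le_trans (ler_norm _) huy).
  move/le_trans; apply.
  rewrite lerD2l exprMn ler_pM2l // ler_piMr ?sqr_ge0 //.
  by rewrite -(real_normK (num_real y)) exprn_ile1.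
rewrite !big_split /= -mulr_sumr hs mulr0 addr0 !sumr_const -mulrnDl.
by rewrite -[leLHS]mulr_natl ler_pM2l ?exp_ge1D // lt0r nB ler0n.
Qed.

Definition shift_ffun k (f : {ffun 'I_k -> G}) t : {ffun 'I_k -> G} :=
  [ffun i => f i - t].

Definition sample_dev A B k (f : {ffun 'I_k -> G}) x : R :=
  \sum_(i < k) ((x - f i \in A)%:R - conv2 A B x).

Definition sample A C k (f : {ffun 'I_k -> G}) w : R :=
  (\sum_(c in C) \sum_(i < k) (w - c - f i \in A)%:R) / (k%:R * #|C|%:R).

(* Controlling exponential moments over all x at once lets Jensen's inequality
   over C turn them into a bound uniform in w, at the cost of a factor
   1/gamma instead of the factor |G| of a union bound. *)
Definition sample_weight A B k (s : R) (f : {ffun 'I_k -> G}) : R :=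
  \sum_x (exp (s * sample_dev A B f x) + exp (- s * sample_dev A B f x)).

Lemma sample_weight_total A B k (s : R) : B != set0 -> `|s| <= 1 / 2 ->
  \sum_(f in ffun_on (mem B)) @sample_weight A B k s f <=
  2 * #|G|%:R * (#|B|%:R ^+ k * exp (2 * s ^+ 2 * k%:R)).
Proof.
move=> B0 hs; rewrite /sample_weight exchange_big /=.
have H u x : `|u| <= 1 / 2 ->
   \sum_(f in ffun_on (mem B)) exp (u * @sample_dev A B k f x) <=
    #|B|%:R ^+ k * exp (2 * u ^+ 2 * k%:R).
  move=> hu.
  under eq_bigr => f _ do rewrite mulr_sumr exp_sum.
  (* Independence of the samples: the sum over tuples of a product is the k-th power of a single
     sum. *)
  rewrite -(bigA_distr_big _ (fun i b => exp (u * ((x - b \in A)%:R - conv2 A B x)))).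
  rewrite prodr_const card_ord mulr_natr -expRX -exprMn.
  apply: lerXn2r; rewrite ?nnegrE; last exact: exp_moment.
    by apply: sumr_ge0 => *; rewrite ltW ?exp_gt0.
  by rewrite mulr_ge0 ?ler0n ?ltW ?exp_gt0.
rewrite -mulrA [#|G|%:R * _]mulr_natl -sumr_const mulr_sumr; apply: ler_sum => x _.
rewrite big_split /= [2 * (_ * _)]mulr_natl mulr2n lerD ?H //.
by rewrite -(sqrrN s) H ?normrN.
Qed.

(** Jensen over [C], with parameter [e / 4] and then [- e / 4], bounds the exponential of the error
    by the weight divided by [|C|]. *)
Lemma sample_close A B C k (e : R) (f : {ffun 'I_k -> G}) w :
    C != set0 -> (0 < k)%nat -> 0 < e ->
    4 * #|G|%:R / #|C|%:R <= exp (k%:R * e ^+ 2 / 8) ->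
    sample_weight A B (e / 4) f <= 4 * #|G|%:R * exp (2 * (e / 4) ^+ 2 * k%:R) ->
  `|sample A C f w - conv3 A B C w| <= e.
Proof.
move=> C0 k0 e0 hk hf.
have nC : (0 < #|C|%:R :> R) by rewrite ltr0n card_gt0.
have nk : (0 < k%:R :> R) by rewrite ltr0n.
have hdev : \sum_(c in C) sample_dev A B f (w - c) =
    k%:R * #|C|%:R * (sample A C f w - conv3 A B C w).
  rewrite mulrBr /sample mulrC divfK ?mulf_neq0 ?lt0r_neq0 //.
  rewrite /conv3 -mulrA (mulrC #|C|%:R) divfK ?lt0r_neq0 // mulr_sumr -sumrB.
  apply: eq_bigr => c _.
  by rewrite /sample_dev sumrB sumr_const card_ord mulr_natl.
have key (s : R) : (s == e / 4) || (s == - (e / 4)) ->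
    exp (s * k%:R * (sample A C f w - conv3 A B C w)) <=
    exp (k%:R * e ^+ 2 / 8 + 2 * (e / 4) ^+ 2 * k%:R).
  move=> hs.
  have h1 := exp_jensen (fun c => s * sample_dev A B f (w - c)) C0.
  have h2 : \sum_(c in C) exp (s * sample_dev A B f (w - c)) <=
            sample_weight A B (e / 4) f.
    (* The points [w - c] are distinct; all other points and the opposite sign contribute positive
       terms. *)
    rewrite /sample_weight [leRHS](reindex_inj (inv_inj (subKr w))) /=.
    rewrite [leRHS](bigID (mem C)) /= -[leLHS]addr0.
    apply: lerD; last by apply: sumr_ge0 => c _; rewrite addr_ge0 ?ltW ?exp_gt0.
    apply: ler_sum => c _.
    by case/orP: hs => /eqP ->; rewrite ?lerDl ?lerDr ltW ?exp_gt0.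
  have := le_trans h1 (le_trans h2 hf).
  rewrite -mulr_sumr hdev.
  have -> : s * (k%:R * #|C|%:R * (sample A C f w - conv3 A B C w)) / #|C|%:R =
            s * k%:R * (sample A C f w - conv3 A B C w).
    by field; rewrite lt0r_neq0.
  rewrite mulrC -ler_pdivlMr // => /le_trans; apply.
  by rewrite expD mulrAC ler_pM2r ?exp_gt0.
rewrite ler_norml.
have e1 : 0 < e / 4 * k%:R by rewrite mulr_gt0 // divr_gt0.
(* Both terms equal [k e^2 / 8], so dividing by [k e / 4] leaves exactly [e]. *)
have E : k%:R * e ^+ 2 / 8 + 2 * (e / 4) ^+ 2 * k%:R = e / 4 * k%:R * e by field.
have := key (e / 4); rewrite eqxx => /(_ isT).
have := key (- (e / 4)); rewrite eqxx orbT => /(_ isT).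
rewrite !ler_exp E !mulNr -mulrN !ler_pM2l // => hm ->.
by rewrite andbT lerNl.
Qed.

Lemma shift_ffun_inj k t : injective (fun f : {ffun 'I_k -> G} => shift_ffun f t).
Proof.
move=> f g /ffunP h; apply/ffunP => i; have := h i.
by rewrite !ffunE => /addIr.
Qed.

Lemma sample_shift A C k (f : {ffun 'I_k -> G}) t w :
  sample A C (shift_ffun f t) w = sample A C f (w + t).
Proof.
congr (_ / _); apply: eq_bigr => c _; apply: eq_bigr => i _.
by rewrite ffunE opprB addrA [w + t - c]addrAC.
Qed.

(** Good tuples approximate [conv3] everywhere. Some tuple [a] has many translates [a - t] that are
    good; these [t] form [T], and any two of them compare two values of [conv3] with one sample
    value. *)
Lemma almost_periods A B C k (e : R) :
    B != set0 -> C != set0 -> (0 < k)%nat -> 0 < e <= 2 ->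
    4 * #|G|%:R / #|C|%:R <= exp (k%:R * e ^+ 2 / 8) ->
  exists T : {set G},
    #|G|%:R * (#|B|%:R / #|G|%:R) ^+ k / 2 <= #|T|%:R :> R /\
    forall t t' w, t \in T -> t' \in T ->
      `|conv3 A B C (w + t - t') - conv3 A B C w| <= 2 * e.
Proof.
move=> B0 C0 k0 /andP[e0 e2] hk.
have nG : (0 < #|G|%:R :> R).
  by rewrite ltr0n; apply/card_gt0P; exists 0.
pose E : R := exp (2 * (e / 4) ^+ 2 * k%:R).
have E0 : 0 < E by exact: exp_gt0.
pose good := [set f in ffun_on (mem B) |
  sample_weight A B (e / 4) (f : {ffun 'I_k -> G}) <= 4 * #|G|%:R * E].
have cardB : #|[set f in ffun_on (mem B) : {pred {ffun 'I_k -> G}}]| = expn #|B| k.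
  by rewrite cardsE card_ffun_on card_ord.
(* Markov: a bad tuple weighs over twice the average bound, so at least half of the tuples are
   good. *)
have good_large : #|B|%:R ^+ k / 2 <= #|good|%:R :> R.
  have he : `|e / 4| <= 1 / 2 by rewrite ger0_norm; lra.
  have h := sample_weight_total A k B0 he.
  have h2 : 4 * #|G|%:R * E * (#|B|%:R ^+ k - #|good|%:R) <=
     \sum_(f in ffun_on (mem B)) @sample_weight A B k (e / 4) f.
    rewrite (bigID (mem good)) /=.
    rewrite -[leLHS]add0r; apply: lerD.
      apply: sumr_ge0 => f _; apply: sumr_ge0 => x _.
      by rewrite addr_ge0 ?ltW ?exp_gt0.
    have -> : #|B|%:R ^+ k - #|good|%:R =
       \sum_(f in [set f in ffun_on (mem B)] :\: good) 1 :> R.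
      rewrite sumr_const cardsD (setIidPr _) ?cardB ?natrB ?natrX //.
        by rewrite -cardB subset_leq_card //; apply/subsetP => f; rewrite !inE => /andP[].
      by apply/subsetP => f; rewrite !inE => /andP[].
    rewrite mulr_sumr (eq_bigl (fun f =>
      (f \in ffun_on (mem B)) && (f \notin good))); last first.
      by move=> f; rewrite !inE andbC.
    apply: ler_sum => f /andP[fB]; rewrite inE fB /= -ltNge mulr1.
    exact: ltW.
  have := le_trans h2 h.
  rewrite -/E.
  have -> : 2 * #|G|%:R * (#|B|%:R ^+ k * E) = 4 * #|G|%:R * E * (#|B|%:R ^+ k / 2).
    by field.
  rewrite ler_pM2l ?mulr_gt0 //; lra.
pose X : R := #|G|%:R * (#|B|%:R / #|G|%:R) ^+ k / 2.
pose T a := [set t | shift_ffun a t \in good].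
(* Double counting of pairs [(a, t)], with [a] ranging over all tuples of [G], not only those of
   [B]. *)
have [a ha] : exists a, X <= #|T a|%:R.
  apply/existsP; apply: contraT; rewrite negb_exists => /forallP h.
  have h1 : \sum_(a : {ffun 'I_k -> G}) #|T a|%:R < \sum_(a : {ffun 'I_k -> G}) X.
    apply: ltr_sum => [|a _]; last by rewrite ltNge.
    by apply/hasP; exists [ffun=> 0] => //; rewrite mem_index_enum.
  have h2 : \sum_(a : {ffun 'I_k -> G}) #|T a|%:R = #|G|%:R * #|good|%:R :> R.
    have E1 a : #|T a|%:R = \sum_t (shift_ffun a t \in good)%:R :> R.
      rewrite -sum1_card natr_sum [RHS]big_mkcond /= big_mkcond.
      by apply: eq_bigr => t _; rewrite inE; case: ifP.
    under eq_bigr do rewrite E1.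
    rewrite exchange_big /= mulr_natl -sumr_const; apply: eq_bigr => t _.
    have -> : #|good|%:R = \sum_f (f \in good)%:R :> R.
      by rewrite -sum1_card natr_sum big_mkcond; apply: eq_bigr => f _; case: ifP.
    by rewrite [RHS](reindex_inj (@shift_ffun_inj k t)).
  move: h1; rewrite h2 sumr_const card_ffun card_ord -[ltRHS]mulr_natl natrX.
  have -> : #|G|%:R ^+ k * X = #|G|%:R * (#|B|%:R ^+ k / 2).
    rewrite /X expr_div_n; field.
    by rewrite ?expf_neq0 ?lt0r_neq0.
  by rewrite ltr_pM2l // ltNge good_large.
exists (T a); split=> // t t' w.
rewrite !inE => /andP[_ ht] /andP[_ ht'].
have := sample_close w C0 k0 e0 hk ht.
have := sample_close (w + t - t') C0 k0 e0 hk ht'.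
rewrite !sample_shift subrK => h1 h2.
(* The common sample value is that of [a] at [w + t = (w + t - t') + t']. *)
have -> : conv3 A B C (w + t - t') - conv3 A B C w =
  (sample A C a (w + t) - conv3 A B C w) - (sample A C a (w + t) - conv3 A B C (w + t - t')).
  by ring.
by rewrite (le_trans (ler_normB _ _)) // mulr_natl mulr2n lerD.
Qed.
End AlmostPeriods.

(** * Dissociated lists *)

Section Dissociation.
Variable G : finZmodType.

(** The span with coefficients in {-1, 0, 1}; [x - l] and [x + l] stand for coefficients 1 and -1 of
    [l]. *)
Fixpoint inspan (s : seq G) (x : G) : bool :=
  if s is l :: s' then [|| inspan s' x, inspan s' (x - l) | inspan s' (x + l)]
  else x == 0.

(* Equivalent to the absence of nontrivial relations with coefficients in
   {-1, 0, 1}: look at the first element occurring in the relation. *)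
Fixpoint dissociated (s : seq G) : bool :=
  if s is l :: s' then ~~ inspan s' l && dissociated s' else true.

Lemma inspanN s x : inspan s (- x) = inspan s x.
Proof.
elim: s x => /= [|l s IH] x; first by rewrite oppr_eq0.
have -> : - x + l = - (x - l) by rewrite opprB addrC.
by rewrite -opprD !IH [inspan s (x + l) || _]orbC.
Qed.

(** Greedy extension: prepending an element outside the span keeps the list dissociated, and the
    size bound stops the process. *)
Lemma exists_maximal_dissociated (P : pred G) D :
    (forall s, dissociated s -> all P s -> (size s <= D)%nat) ->
  exists s, [/\ dissociated s, all P s & forall x, P x -> inspan s x].
Proof.
move=> hD.
have step n : forall s, dissociated s -> all P s -> (D - size s <= n)%nat ->
    exists s, [/\ dissociated s, all P s & forall x, P x -> inspan s x].
  elim: n => [|n IH] s hs hP hn;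
    have [/forallP h|/forallPn[x]] := boolP [forall x, P x ==> inspan s x];
    rewrite ?negb_imply;
    try by exists s; split=> // x Px; have := h x; rewrite Px.
    case/andP=> Px hx; have := hD (x :: s); rewrite /= hx Px hs hP => /(_ isT isT) h.
    by move: hn; rewrite leqn0 subn_eq0 leqNgt h.
  case/andP=> Px hx; have := hD (x :: s); rewrite /= hx Px hs hP => /(_ isT isT) h.
  by apply: (IH (x :: s)); rewrite /= ?hx ?Px //; lia.
by apply: (step D [::]); rewrite ?leq_subr.
Qed.
End Dissociation.

(** * Smoothing over differences *)

Section Smoothing.
Variables (G : finZmodType) (T : {set G}).
Hypothesis T0 : T != set0.

(** Convolution with the uniform measures on [T] and on [-T]; its Fourier multiplier is the squared
    modulus of [mean_chi]. *)
Definition smooth (f : G -> R) (w : G) : R :=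
  (\sum_(t in T) \sum_(t' in T) f (w + t - t')) / #|T|%:R ^+ 2.

Definition almost_invariant (f : G -> R) (e : R) :=
  forall t t' w, t \in T -> t' \in T -> `|f (w + t - t') - f w| <= e.

Let nT : (0 < #|T|%:R :> R). Proof. by rewrite ltr0n card_gt0. Qed.

(** Two functions and two base points, so as to cover both a translate of one function and a
    comparison with a constant. *)
Lemma smooth_dist (f g : G -> R) e w w' :
  (forall t t', t \in T -> t' \in T -> `|f (w + t - t') - g (w' + t - t')| <= e) ->
  `|smooth f w - smooth g w'| <= e.
Proof.
move=> h; rewrite /smooth -mulrBl normrM (@ger0_norm _ (_^-1)); last first.
  by rewrite invr_ge0 exprn_ge0 // ltW.
rewrite ler_pdivrMr ?exprn_gt0 // expr2 mulrCA mulr_natl -sumr_const -sumrB.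
rewrite (le_trans (ler_norm_sum _ _ _)) //; apply: ler_sum => t tT.
rewrite mulrC mulr_natl -sumr_const -sumrB (le_trans (ler_norm_sum _ _ _)) //.
by apply: ler_sum => t' t'T; exact: h.
Qed.

Lemma smooth_invariant f e : almost_invariant f e -> almost_invariant (smooth f) e.
Proof.
move=> h t t' w tT t'T; apply: smooth_dist => u u' uT u'T.
by rewrite [w + t - t' + u - u'](ACl (1*4*5*2*3)%AC) /=; exact: h.
Qed.

Lemma smooth_close f e w : almost_invariant f e -> `|smooth f w - f w| <= e.
Proof.
move=> h; have -> : f w = smooth (fun=> f w) w.
  rewrite /smooth !sumr_const -mulrnA -[_ *+ _]mulr_natr natrM -expr2 mulfK //.
  by rewrite expf_neq0 // lt0r_neq0.
by apply: smooth_dist => t t' tT t'T; exact: h.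
Qed.

Lemma iter_smooth_close f e l w : almost_invariant f e ->
  `|iter l smooth f w - f w| <= l%:R * e.
Proof.
move=> h; have hl n : almost_invariant (iter n smooth f) e.
  by elim: n => //= n; exact: smooth_invariant.
elim: l => [|l IH] /=; first by rewrite subrr normr0 mul0r.
have -> : smooth (iter l smooth f) w - f w =
  (smooth (iter l smooth f) w - iter l smooth f w) + (iter l smooth f w - f w) by ring.
rewrite (le_trans (ler_normD _ _)) // -natr1 mulrDl mul1r addrC lerD //.
exact: smooth_close.
Qed.
End Smoothing.

(** Cells of width [2 / M] on [-1, 1]; the extra one holds only [r = 1]. For [|r| <= 1] the index is
    at most [M], so [inord] keeps it. *)
Definition cell (M : nat) (r : R) : 'I_M.+1 := inord (Num.truncn ((r + 1) * M%:R / 2)).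

Lemma cell_close (M : nat) (r r' : R) : (0 < M)%nat -> `|r| <= 1 -> `|r'| <= 1 ->
  cell M r = cell M r' -> `|r - r'| <= 2 / M%:R.
Proof.
move=> M0; rewrite (ler_norml r) (ler_norml r') => /andP[r1 r2] /andP[r3 r4].
have nM : (0 < M%:R :> R) by rewrite ltr0n.
have key (s : R) : -1 <= s -> s <= 1 ->
    (cell M s)%:R <= (s + 1) * M%:R / 2 < (cell M s)%:R + 1.
  move=> s1 s2; set y := _ / 2; have y0 : 0 <= y by rewrite /y divr_ge0 ?mulr_ge0 //; lra.
  have := truncn_itv y0; rewrite /cell -/y inordK ?natr1 //.
  rewrite ltnS -(ler_nat R) (@le_trans _ _ y) ?truncn_le // /y.
  by rewrite ler_pdivrMr // mulrC ler_wpM2l //; lra.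
move=> E; have /andP[a1 a2] := key r r1 r2; have /andP[a3 a4] := key r' r3 r4.
rewrite -E in a3 a4.
have h : `|(r - r') * M%:R| <= 2.
  rewrite ler_norml.
  have -> : (r - r') * M%:R = ((r + 1) * M%:R / 2 - (r' + 1) * M%:R / 2) * 2 by field.
  by apply/andP; split; lra.
rewrite ler_pdivlMr //; move: h; by rewrite normrM (ger0_norm (ltW nM)).
Qed.

(** Multiplication by ['i] turns the imaginary part, up to sign, into a real part, so cells of real
    parts suffice. *)
Lemma norm_le_ReD (z : R[i]) :
  `|z| <= (`|complex.Re z| + `|complex.Re (z * 'i)|)%:C.
Proof.
rewrite ReiNIm normrN {1}[z]complexE (le_trans (ler_normD _ _)) // rmorphD /=.
rewrite normrM.
have nE (x : R) : `|x%:C| = `|x|%:C by rewrite normc_def /= expr0n /= addr0 sqrtr_sqr.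
have -> : `|'i| = 1 :> R[i].
  by rewrite normc_def /= expr0n /= expr1n add0r sqrtr1.
by rewrite mul1r !nE.
Qed.

(** Used to find a point where [conv3] is at least its mean, the density of [A]. *)
Lemma conv3_sum (G : finZmodType) (A B C : {set G}) : B != set0 -> C != set0 ->
  \sum_w conv3 A B C w = #|A|%:R.
Proof.
move=> B0 C0.
have nB : (#|B|%:R : R) != 0 by rewrite pnatr_eq0 cards_eq0.
have nC : (#|C|%:R : R) != 0 by rewrite pnatr_eq0 cards_eq0.
have E1 y : \sum_x (x - y \in A)%:R = #|A|%:R :> R.
  rewrite (reindex_inj (addIr y)) /= -sum1_card natr_sum [RHS]big_mkcond /=.
  by apply: eq_bigr => x _; rewrite addrK; case: ifP.
have E2 c : \sum_w conv2 A B (w - c) = #|A|%:R.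
  rewrite (reindex_inj (addIr c)) /= /conv2 -mulr_suml exchange_big /=.
  under eq_bigr => b _.
    under eq_bigr => x _ do rewrite addrK.
    rewrite E1; over.
  by rewrite sumr_const -[_ *+ #|B|]mulr_natr mulfK.
rewrite /conv3 -mulr_suml exchange_big /=.
under eq_bigr do rewrite E2.
by rewrite sumr_const -[_ *+ #|C|]mulr_natr mulfK.
Qed.

(** * Fourier analysis on a self-dual finite abelian group *)

Section Fourier.
(* [chi] identifies [G] with its dual group. *)
Variables (G : finZmodType) (chi : G -> G -> R[i]).
Hypothesis chiDl : forall x y z, chi (x + y) z = chi x z * chi y z.
Hypothesis chiDr : forall x y z, chi x (y + z) = chi x y * chi x z.
Hypothesis chi_norm : forall x y, `|chi x y| = 1.
Hypothesis chi_suml : forall y, \sum_x chi x y = (#|G| * (y == 0))%:R.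
Hypothesis chi_sumr : forall x, \sum_y chi x y = (#|G| * (x == 0))%:R.
Implicit Types (A B C T : {set G}) (w x t xi : G).

Lemma chi_neq0 x y : chi x y != 0.
Proof. by rewrite -normr_eq0 chi_norm oner_neq0. Qed.

Lemma chi0l y : chi 0 y = 1.
Proof.
by apply: (mulfI (chi_neq0 0 y)); rewrite -chiDl addr0 mulr1.
Qed.

Lemma chi0r y : chi y 0 = 1.
Proof.
by apply: (mulfI (chi_neq0 y 0)); rewrite -chiDr addr0 mulr1.
Qed.

Lemma chi_conj x y : (chi x y)^* = (chi x y)^-1.
Proof. by rewrite invC_norm chi_norm expr1n invr1 mul1r. Qed.

Lemma chiNl x y : chi (- x) y = (chi x y)^*.
Proof.
rewrite chi_conj; apply: (mulfI (chi_neq0 x y)).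
by rewrite -chiDl subrr chi0l divff ?chi_neq0.
Qed.

Lemma chiNr x y : chi x (- y) = (chi x y)^*.
Proof.
rewrite chi_conj; apply: (mulfI (chi_neq0 x y)).
by rewrite -chiDr subrr chi0r divff ?chi_neq0.
Qed.

(** Distance to 1 is subadditive under products of unimodular numbers and invariant under
    conjugation: each coefficient costs at most [eta]. *)
Lemma inspan_chi s xi v (eta : R[i]) : inspan s xi ->
    (forall l, l \in s -> `|chi l v - 1| <= eta) ->
  `|chi xi v - 1| <= (size s)%:R * eta.
Proof.
elim: s xi => [|l s IH] xi /=.
  by move=> /eqP-> _; rewrite chi0l subrr normr0 mul0r.
move=> h hs.
have hl : `|chi l v - 1| <= eta by apply: hs; rewrite mem_head.
have e0 : 0 <= eta by exact: le_trans (normr_ge0 _) hl.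
have {}IH x : inspan s x -> `|chi x v - 1| <= (size s)%:R * eta.
  by move=> hx; apply: IH => // k ks; apply: hs; rewrite inE ks orbT.
rewrite -natr1 mulrDl mul1r.
have key x y : xi = x + y -> inspan s x -> `|chi y v - 1| <= eta ->
   `|chi xi v - 1| <= (size s)%:R * eta + eta.
  move=> -> hx hy; rewrite chiDl.
  have -> : chi x v * chi y v - 1 = (chi x v - 1) + chi x v * (chi y v - 1) by ring.
  by rewrite (le_trans (ler_normD _ _)) // normrM chi_norm mul1r lerD ?IH.
case/or3P: h => h.
- by rewrite (le_trans (IH _ h)) // lerDl.
- by apply: (key _ l _ h); rewrite ?subrK.
- apply: (key _ (- l) _ h); rewrite ?addrK //.
  by rewrite chiNl -[1]conjC1 -rmorphB /= norm_conjC.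
Qed.

(** * Riesz products and Chang's theorem *)

Definition riesz_factor (u : G -> R[i]) (l x : G) : R := complex.Re (u l * chi l x).

(** Expanding the factor of [l] replaces [xi] by [xi], [xi + l] and [xi - l], all outside the span
    of the tail; orthogonality ends the induction. *)
Lemma riesz_vanish (u : G -> R[i]) (a b : R) s xi : dissociated s ->
    ~~ inspan s xi ->
  \sum_x chi xi x * (\prod_(l <- s) (a + b * riesz_factor u l x))%:C = 0.
Proof.
elim: s xi => [|l s IH] xi /=.
  move=> _ h; under eq_bigr do rewrite big_nil mulr1.
  by rewrite chi_sumr (negbTE h) muln0.
move=> /andP[hl hs]; rewrite !negb_or => /and3P[h1 h2 h3].
pose p x := (\prod_(l <- s) (a + b * riesz_factor u l x))%:C.
have E x : chi xi x * (\prod_(j <- l :: s) (a + b * riesz_factor u j x))%:C =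
   a%:C * (chi xi x * p x) + b%:C / 2 * u l * (chi (xi + l) x * p x)
   + b%:C / 2 * (u l)^* * (chi (xi - l) x * p x).
  rewrite big_cons rmorphM rmorphD rmorphM /= /riesz_factor ReJ_add.
  rewrite -[conjc _]/((_ : R[i])^*) rmorphM /= !chiDl chiNl -/(p x).
  by field.
under eq_bigr do rewrite E.
by rewrite !big_split /= -!mulr_sumr !IH // !mulr0 !addr0.
Qed.

(** The oscillating part of the factor of [l] twists by [l] and [- l], which dissociation keeps
    outside the span of the tail; only [a] survives. *)
Lemma riesz_total (u : G -> R[i]) (a b : R) s : dissociated s ->
  \sum_x (\prod_(l <- s) (a + b * riesz_factor u l x)) = #|G|%:R * a ^+ size s.
Proof.
elim: s => [|l s IH] /=.
  by move=> _; under eq_bigr do rewrite big_nil; rewrite sumr_const mulr1.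
move=> /andP[hl hs].
under eq_bigr do rewrite big_cons mulrDl.
rewrite big_split /= -mulr_sumr IH // mulrCA -exprS.
rewrite [X in _ + X](_ : _ = 0) ?addr0 //.
pose p x := (\prod_(l <- s) (a + b * riesz_factor u l x)).
apply: complexI; rewrite rmorph_sum rmorph0 /=.
have E x : (b * riesz_factor u l x * p x)%:C =
   b%:C / 2 * u l * (chi l x * (p x)%:C)
   + b%:C / 2 * (u l)^* * (chi (- l) x * (p x)%:C).
  rewrite !rmorphM /= /riesz_factor ReJ_add.
  rewrite -[conjc _]/((_ : R[i])^*) rmorphM /= chiNl.
  by field.
under eq_bigr do rewrite E.
rewrite !big_split /= -!mulr_sumr !riesz_vanish ?inspanN //.
by rewrite !mulr0 addr0.
Qed.

(** Threshold 1/2: off this set one smoothing shrinks a coefficient by a factor 4 or more. *)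
Definition large_spectrum T : pred G :=
  fun xi => #|T|%:R / 2 <= `|\sum_(t in T) chi xi t|.

(** With d the length of [s], Jensen bounds an exponential sum over [T] below by [|T| exp (d / 16)];
    a Riesz product bounds it above by [|G| (1 + 1/32)^d <= |G| exp (d / 32)]. *)
Lemma chang_bound T s : T != set0 -> dissociated s -> all (large_spectrum T) s ->
  #|T|%:R * exp ((size s)%:R / 32) <= #|G|%:R.
Proof.
move=> T0 hs /allP hT.
have nT : (0 < #|T|%:R :> R) by rewrite ltr0n card_gt0.
pose S l := \sum_(t in T) chi l t.
(* The phase making [u l * S l] equal to the modulus of [S l]. It is 0 when [S l = 0], hence only
   modulus at most 1. *)
pose u l := (S l)^* / `|S l|.
have u1 l : `|u l| <= 1.
  rewrite /u normrM normfV normr_id norm_conjC.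
  by have [->|h] := eqVneq (S l) 0; rewrite ?normr0 ?mul0r ?ler01 // divff ?normr_eq0.
pose r := riesz_factor u.
have r1 l x : `|r l x| <= 1.
  rewrite -lecR (le_trans (normc_ge_Re _)) // normrM chi_norm mulr1; exact: u1.
have rT l : l \in s -> #|T|%:R / 2 <= \sum_(t in T) r l t.
  move=> /hT; rewrite /large_spectrum -/(S l) => h.
  rewrite /r /riesz_factor -raddf_sum -mulr_sumr -/(S l).
  have -> : u l * S l = `|S l|.
    rewrite /u mulrAC [_^* * _]mulrC -normCK expr2.
    by have [->|h0] := eqVneq (S l) 0; rewrite ?normr0 ?mul0r // mulfK ?normr_eq0.
  rewrite -lecR RRe_real ?normr_real // (le_trans _ h) //.
  by rewrite rmorphM fmorphV !rmorph_nat.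
pose d : R := (size s)%:R.
have h1 : #|T|%:R * exp (d / 16) <= \sum_(x in T) exp (\sum_(l <- s) (1 / 8) * r l x).
  apply: le_trans (exp_jensen _ T0).
  rewrite ler_pM2l // ler_exp ler_pdivlMr // exchange_big /=.
  have -> : d / 16 * #|T|%:R = \sum_(l <- s) (1 / 8) * (#|T|%:R / 2).
    rewrite big_const_seq count_predT iter_addr_0 -mulr_natl /d; by field.
  rewrite big_seq [leRHS]big_seq; apply: ler_sum => l hl.
  by rewrite -mulr_sumr ler_pM2l ?rT //; lra.
(* [exp_le_quadratic] at [r / 8]; the product is nonnegative, so the sum extends from [T] to [G]. *)
have h2 : \sum_(x in T) exp (\sum_(l <- s) (1 / 8) * r l x) <=
          \sum_x \prod_(l <- s) (1 + 2 * (1/8) ^+ 2 + (1/8) * r l x).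
  rewrite [leRHS](bigID (mem T)) /= -[leLHS]addr0; apply: lerD.
    apply: ler_sum => x _; rewrite exp_sum; apply: ler_prod => l _.
    rewrite ltW ?exp_gt0 //=.
    have := r1 l x; rewrite ler_norml => /andP[ra rb].
    have hh : 1 / 8 * r l x <= 1 / 2 by lra.
    rewrite (le_trans (exp_le_quadratic hh)) //.
    have : (r l x) ^+ 2 <= 1 by rewrite -(real_normK (num_real _)) exprn_ile1.
    rewrite exprMn; lra.
  apply: sumr_ge0 => x _; apply: prodr_ge0 => l _.
  have := r1 l x; rewrite ler_norml => /andP[ra rb]; nra.
rewrite riesz_total // in h2.
have h3 : (1 + 2 * (1 / 8) ^+ 2) ^+ size s <= exp (d / 32).
  have -> : d / 32 = (2 * (1/8) ^+ 2) *+ size s by rewrite -mulr_natl /d; by field.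
  by rewrite -expRX lerXn2r ?nnegrE ?exp_ge1D ?ltW ?exp_gt0 //; lra.
have := le_trans h1 (le_trans h2 _); move/(_ (#|G|%:R * exp (d / 32))).
rewrite ler_wpM2l // => /(_ isT).
have -> : d / 16 = d / 32 + d / 32 by field.
by rewrite expD mulrA ler_pM2r ?exp_gt0.
Qed.

(** * Fourier expansions and the effect of smoothing *)

Definition mean_chi T xi : R[i] := (\sum_(t in T) chi xi t) / #|T|%:R.

Definition expansion (f : G -> R) (c : G -> R[i]) :=
  forall w, (f w)%:C = \sum_xi c xi * chi xi w.

Lemma expansion_smooth T f c : expansion f c ->
  expansion (smooth T f) (fun xi => c xi * `|mean_chi T xi| ^+ 2).
Proof.
move=> h w; rewrite /smooth rmorphM fmorphV rmorphXn rmorph_nat rmorph_sum /=.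
under eq_bigr => t _.
  rewrite rmorph_sum /=.
  under eq_bigr => t' _ do rewrite h.
  over.
under eq_bigr => t _ do rewrite exchange_big /=.
rewrite exchange_big /= mulr_suml; apply: eq_bigr => xi _.
rewrite /mean_chi normCK rmorphM fmorphV /= rmorph_nat rmorph_sum /=.
under eq_bigr => t _.
  under eq_bigr => t' _.
    rewrite 2!chiDr chiNr mulrA.
    over.
  rewrite -mulr_sumr mulrA.
  over.
rewrite -mulr_suml -mulr_sumr expr2 invfM.
set a := \sum_(t in T) _; set b := \sum_(t in T) _.
by ring.
Qed.

Lemma expansion_iter_smooth T f c l : expansion f c ->
  expansion (iter l (smooth T) f) (fun xi => c xi * `|mean_chi T xi| ^+ (2 * l)).
Proof.
move=> h; elim: l => [|l IH] w /=.
  by rewrite h; under [RHS]eq_bigr do rewrite muln0 expr0 mulr1.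
rewrite (expansion_smooth T IH); apply: eq_bigr => xi _.
by rewrite mulnS exprD; set u := _ ^+ 2; set v := _ ^+ (2 * l); ring.
Qed.

Lemma parseval T : T != set0 ->
  \sum_xi `|mean_chi T xi| ^+ 2 = #|G|%:R / #|T|%:R.
Proof.
move=> T0; have nT : (#|T|%:R : R[i]) != 0 by rewrite pnatr_eq0 cards_eq0.
have E xi : `|mean_chi T xi| ^+ 2 =
   (\sum_(t in T) \sum_(t' in T) chi xi (t - t')) / #|T|%:R ^+ 2.
  rewrite /mean_chi normCK rmorphM fmorphV /= rmorph_nat rmorph_sum /=.
  rewrite mulrACA -invfM -expr2; congr (_ / _).
  rewrite mulr_suml; apply: eq_bigr => t _; rewrite mulr_sumr.
  by apply: eq_bigr => t' _; rewrite chiDr chiNr.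
under eq_bigr do rewrite E.
rewrite -mulr_suml exchange_big /=.
under eq_bigr => t tT.
  rewrite exchange_big /=.
  under eq_bigr => t' _ do rewrite chi_suml subr_eq0.
  rewrite (bigD1 t) //= eqxx muln1 big1 ?addr0; last first.
    by move=> t' /andP[_ /negbTE h]; rewrite eq_sym h muln0.
  over.
rewrite sumr_const -mulr_natr; field.
by [].
Qed.

Lemma mean_chi_le1 T xi : T != set0 -> `|mean_chi T xi| <= 1.
Proof.
move=> T0; have nT : (0 < #|T|%:R :> R[i]) by rewrite ltr0n card_gt0.
rewrite /mean_chi normrM normfV normr_nat ler_pdivrMr // mul1r.
rewrite (le_trans (ler_norm_sum _ _ _)) // -sumr_const.
by apply: ler_sum => t _; rewrite chi_norm.
Qed.

(** The factor of [C] has modulus at most 1; AM-GM and Parseval on the other two give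
    [(1 + |A|/|B|) / 2], at most [|G|/|B|]. *)
Lemma expansion_conv3 A B C : A != set0 -> B != set0 -> C != set0 ->
  exists c, expansion (conv3 A B C) c /\ \sum_xi `|c xi| <= #|G|%:R / #|B|%:R.
Proof.
move=> A0 B0 C0.
have nA : (0 < #|A|%:R :> R[i]) by rewrite ltr0n card_gt0.
have nB : (0 < #|B|%:R :> R[i]) by rewrite ltr0n card_gt0.
have nC : (0 < #|C|%:R :> R[i]) by rewrite ltr0n card_gt0.
have nG : (0 < #|G|%:R :> R[i]) by rewrite ltr0n; apply/card_gt0P; exists 0.
pose c xi := #|A|%:R / #|G|%:R * (mean_chi A xi)^* * (mean_chi B xi)^* * (mean_chi C xi)^*.
exists c; split.
  move=> w; rewrite /conv3 /conv2 rmorphM fmorphV rmorph_nat rmorph_sum /=.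
  have E x : ((x \in A)%:R)%:C = \sum_xi (\sum_(a in A) chi xi (x - a)) / #|G|%:R.
    rewrite rmorph_nat -mulr_suml exchange_big /=.
    under eq_bigr => a _ do rewrite chi_suml subr_eq0.
    have [xA|xA] := boolP (x \in A).
      rewrite (bigD1 x) //= eqxx muln1 big1 ?addr0 ?divff ?lt0r_neq0 //.
      by move=> a /andP[_ /negbTE h]; rewrite eq_sym h muln0.
    rewrite big1 ?mul0r // => a aA; case: eqP => [e|]; last by rewrite muln0.
    by move: xA; rewrite e aA.
  have F xi : c xi * chi xi w = (\sum_(c in C) (\sum_(b in B)
      (\sum_(a in A) chi xi (w - c - b - a)) / #|G|%:R) / #|B|%:R) / #|C|%:R.
    under eq_bigr => c0 _.
      under eq_bigr => b _.
        under eq_bigr => a _ do rewrite 3!chiDr !chiNr.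
        rewrite -mulr_sumr.
        over.
      rewrite -2!mulr_suml -mulr_sumr.
      over.
    rewrite -4!mulr_suml -mulr_sumr.
    rewrite /c /mean_chi !rmorphM !fmorphV /= !rmorph_nat !rmorph_sum /=.
    set a := \sum_(t in A) _; set b := \sum_(t in B) _; set d := \sum_(t in C) _.
    by field; rewrite !lt0r_neq0.
  under [RHS]eq_bigr do rewrite F.
  rewrite -mulr_suml exchange_big /=; congr (_ / _); apply: eq_bigr => c0 _.
  rewrite rmorphM fmorphV rmorph_nat rmorph_sum /=.
  rewrite -mulr_suml exchange_big /=; congr (_ / _); apply: eq_bigr => b _.
  by rewrite E.
have h xi : `|c xi| <= #|A|%:R / #|G|%:R / 2 * (`|mean_chi A xi| ^+ 2 + `|mean_chi B xi| ^+ 2).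
  have k0 : 0 <= #|A|%:R / #|G|%:R :> R[i] by rewrite divr_ge0 ?ler0n.
  rewrite /c 3!normrM 3!norm_conjC (ger0_norm k0).
  have h1 := mean_chi_le1 xi C0.
  set a := `|mean_chi A xi|; set b := `|mean_chi B xi|.
  have ha : 0 <= a by rewrite normr_ge0. have hb : 0 <= b by rewrite normr_ge0.
  apply: (@le_trans _ _ (#|A|%:R / #|G|%:R * a * b)).
    by rewrite ler_piMr ?mulr_ge0 ?invr_ge0 ?ler0n.
  rewrite -!mulrA; do 2!rewrite ler_wpM2l ?invr_ge0 ?ler0n //.
  rewrite ler_pdivlMl // -subr_ge0.
  have -> : a ^+ 2 + b ^+ 2 - 2 * (a * b) = (a - b) ^+ 2 by ring.
  by rewrite real_exprn_even_ge0 // rpredB ?ger0_real.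
apply: le_trans (ler_sum _ (fun xi _ => h xi)) _.
rewrite -mulr_sumr big_split /= !parseval //.
have -> : #|A|%:R / #|G|%:R / 2 * (#|G|%:R / #|A|%:R + #|G|%:R / #|B|%:R) =
   (1 + #|A|%:R / #|B|%:R) / 2 :> R[i].
  by field; rewrite !lt0r_neq0.
have hA : #|A|%:R <= #|G|%:R :> R[i] by rewrite ler_nat max_card.
have hB : #|B|%:R <= #|G|%:R :> R[i] by rewrite ler_nat max_card.
rewrite ler_pdivrMr // mulr_natr mulr2n lerD //.
  by rewrite ler_pdivlMr // mul1r.
by rewrite ler_pM2r ?invr_gt0.
Qed.

(** On the large spectrum the multiplier is at most 1 and [chi xi v] is within [eta] of 1; off it
    the multiplier is at most [(1/4)^l] and the distance at most 2. *)
Lemma smooth_translate T f c l v (W eta : R) (w : G) : T != set0 ->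
    expansion f c -> \sum_xi `|c xi| <= W%:C -> 0 <= eta ->
    (forall xi, large_spectrum T xi -> `|chi xi v - 1| <= eta%:C) ->
  `|iter l (smooth T) f (w + v) - iter l (smooth T) f w| <=
     W * (eta + 2 * (1 / 4) ^+ l).
Proof.
move=> T0 hf hc e0 hv.
have nT : (0 < #|T|%:R :> R[i]) by rewrite ltr0n card_gt0.
have W0 : 0 <= W by rewrite -lecR (le_trans _ hc) // sumr_ge0.
have h := expansion_iter_smooth T l hf.
set g := iter l _ f.
have E : (g (w + v) - g w)%:C =
   \sum_xi c xi * `|mean_chi T xi| ^+ (2 * l) * chi xi w * (chi xi v - 1).
  rewrite rmorphB /= !h -sumrB; apply: eq_bigr => xi _.
  by rewrite chiDr; ring.
have nE (x : R) : `|x|%:C = `|x%:C| by rewrite normc_def /= expr0n /= addr0 sqrtr_sqr.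
rewrite -lecR nE E (le_trans (ler_norm_sum _ _ _)) //.
rewrite rmorphM.
apply: le_trans (ler_wpM2r _ hc); last first.
  by rewrite ler0c addr_ge0 // mulr_ge0 // exprn_ge0 //; lra.
rewrite mulr_suml; apply: ler_sum => xi _.
rewrite 3!normrM chi_norm mulr1 -mulrA ler_wpM2l // ger0_norm ?exprn_ge0 //.
rewrite rmorphD /=.
have [hx|hx] := boolP (large_spectrum T xi).
  rewrite -[leLHS]addr0 lerD //.
    by rewrite (le_trans _ (hv _ hx)) // ler_piMl // exprn_ile1 ?mean_chi_le1.
  by rewrite ler0c mulr_ge0 // exprn_ge0 //; lra.
rewrite -[leLHS]add0r lerD ?ler0c // rmorphM rmorphXn mulrC.
have hm : `|mean_chi T xi| <= 1 / 2.
  move: hx; rewrite /large_spectrum /mean_chi -real_ltNge ?realE ?divr_ge0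
    ?ler0n ?normr_ge0 // => /ltW hx.
  by rewrite normrM normfV normr_nat ler_pdivrMr // mul1r mulrC.
rewrite ler_pM ?exprn_ge0 //.
  rewrite (le_trans (ler_normB _ _)) // chi_norm normr1 rmorph_nat -natr1.
  by [].
rewrite exprM /=; have -> : (1 / 4)%:C = (1 / 2) ^+ 2 :> R[i].
  by rewrite rmorphM fmorphV rmorph1 rmorph_nat; field.
by apply: lerXn2r; rewrite ?nnegrE ?exprn_ge0 ?divr_ge0 ?ler01 ?ler0n //
  lerXn2r ?nnegrE ?divr_ge0 ?ler01 ?ler0n.
Qed.
(* [expn] is spelled out because [^] on [nat] is [Nat.pow] once [Reals] is loaded. *)
Lemma exists_return_time (x : G) (s : seq G) (M : nat) :
    (0 < M)%nat ->
  exists t : nat, [/\ (0 < t)%nat, (t <= expn M.+1 (2 * size s))%nat &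
    forall l, l \in s -> `|chi l (x *+ t) - 1| <= (4 / M%:R)%:C].
Proof.
move=> M0; set K := expn _ _.
have ni : `|'i| = 1 :> R[i] by rewrite normc_def /= expr0n /= expr1n add0r sqrtr1.
have hRe (z : R[i]) : `|z| = 1 -> `|complex.Re z| <= 1.
  by move=> hz; have := normc_ge_Re z; rewrite hz -[1]/(1%:C) lecR.
(* [K + 1] times against [K] boxes, two real coordinates per character: two times share a box. *)
pose F (t : 'I_K.+1) : {ffun 'I_(size s) -> 'I_M.+1 * 'I_M.+1} :=
  [ffun i : 'I_(size s) => (cell M (complex.Re (chi (nth 0 s i) (x *+ t))),
              cell M (complex.Re (chi (nth 0 s i) (x *+ t) * 'i)))].
have /injectivePn[a [b ab Fab]] : ~~ injectiveb F.
  apply/negP => /injectiveP /leq_card.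
  by rewrite card_ffun card_prod !card_ord mulnn -expnM ltnn.
wlog lt_ab : a b ab Fab / (a < b)%nat.
  move=> W; case: (ltngtP a b) => h; first exact: (W a b).
  - by apply: (W b a); rewrite // eq_sym.
  - by case/eqP: ab; apply: val_inj.
exists (b - a)%nat; split; first by rewrite subn_gt0.
  by rewrite (leq_trans (leq_subr _ _)) // -ltnS ltn_ord.
move=> l ls; have ils : (index l s < size s)%nat by rewrite index_mem.
have /ffunP/(_ (Ordinal ils)) := Fab; rewrite !ffunE /= nth_index // => -[e1 e2].
set za := chi l (x *+ a) in e1 e2; set zb := chi l (x *+ b) in e1 e2.
have -> : `|chi l (x *+ (b - a)) - 1| = `|za - zb|.
  have -> : zb = za * chi l (x *+ (b - a)).
    by rewrite /za -chiDr -mulrnDr subnKC // ltnW.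
  by rewrite -[za in RHS]mulr1 -mulrA mul1r -mulrBr normrM /za chi_norm mul1r distrC.
rewrite (le_trans (norm_le_ReD _)) // lecR.
have -> : 4 / M%:R = 2 / M%:R + 2 / M%:R :> R by rewrite -mulrDl -natrD.
rewrite mulrBl !raddfB /= lerD //; apply: cell_close => //.
- by rewrite hRe /za ?chi_norm.
- by rewrite hRe /zb ?chi_norm.
- by rewrite hRe // normrM /za chi_norm ni mulr1.
- by rewrite hRe // normrM /zb chi_norm ni mulr1.
Qed.

Lemma chi_mulrn (l v : G) j :
  `|chi l (v *+ j) - 1| <= j%:R * `|chi l v - 1|.
Proof.
elim: j => [|j IH].
  by rewrite mulr0n mul0r chi0r subrr normr0.
rewrite mulrSr chiDr -natr1 mulrDl mul1r.
have -> : chi l (v *+ j) * chi l v - 1 =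
  (chi l (v *+ j) - 1) + chi l (v *+ j) * (chi l v - 1) by ring.
by rewrite (le_trans (ler_normD _ _)) // normrM chi_norm mul1r lerD.
Qed.

Lemma conv3_progression
    (A B C : {set G}) (x : G) (k l M L D : nat) (e : R) :
    A != set0 -> B != set0 -> C != set0 ->
    (0 < k)%nat -> 0 < e <= 2 -> (0 < M)%nat ->
    4 * #|G|%:R / #|C|%:R <= exp (k%:R * e ^+ 2 / 8) ->
    2 * (#|G|%:R / #|B|%:R) ^+ k <= exp (D%:R / 32) ->
    l%:R * e * 16 <= #|A|%:R / #|G|%:R ->
    #|G|%:R / #|B|%:R * (D%:R * (L%:R * (4 / M%:R)) + 2 * (1 / 4) ^+ l) * 4
      <= #|A|%:R / #|G|%:R :> R ->
  exists (w : G) (t : nat), [/\ (0 < t)%nat, (t <= expn M.+1 (2 * D))%nat &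
    forall j, (j < L)%nat ->
      #|A|%:R / #|G|%:R / 2 <= conv3 A B C (w + x *+ t *+ j)].
Proof.
move=> A0 B0 C0 k0 he M0 hk hD hl hM.
have nG : (0 < #|G|%:R :> R) by rewrite ltr0n; apply/card_gt0P; exists 0.
have nB : (0 < #|B|%:R :> R) by rewrite ltr0n card_gt0.
have [T [hT inv]] := almost_periods A B0 C0 k0 he hk.
have nT : (0 < #|T|%:R :> R).
  by apply: lt_le_trans hT; rewrite divr_gt0 // mulr_gt0 // exprn_gt0 // divr_gt0.
have T0 : T != set0 by rewrite -card_gt0 -(ltr0n R).
(* Chang's bound and the size of [T] give [exp (size s / 32) <= 2 (|G|/|B|)^k]. *)
have sizeD s : dissociated s -> all (large_spectrum T) s -> (size s <= D)%nat.
  move=> hs1 hs2; have h := chang_bound T0 hs1 hs2.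
  have : exp ((size s)%:R / 32) <= exp (D%:R / 32).
    apply: le_trans hD.
    have := le_trans (ler_wpM2r (ltW (exp_gt0 _)) hT) h.
    have -> : #|G|%:R * (#|B|%:R / #|G|%:R) ^+ k / 2 * exp ((size s)%:R / 32) =
       #|G|%:R * (exp ((size s)%:R / 32) / (2 * (#|G|%:R / #|B|%:R) ^+ k)).
      by rewrite !expr_div_n; field; rewrite !expf_neq0 ?lt0r_neq0.
    rewrite -[leRHS]mulr1 ler_pM2l // ler_pdivrMr ?mul1r //.
    by rewrite mulr_gt0 // exprn_gt0 // divr_gt0.
  by rewrite ler_exp ler_pM2r ?invr_gt0 // ler_nat.
have [s [hs1 hs2 hs3]] := exists_maximal_dissociated sizeD.
have {sizeD} hsD := sizeD s hs1 hs2.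
have [t [t0 tK ht]] := exists_return_time x s M0.
have [w hw] : exists w, #|A|%:R / #|G|%:R <= conv3 A B C w.
  apply/existsP; apply: contraT; rewrite negb_exists => /forallP h.
  have : \sum_w conv3 A B C w < \sum_(w : G) (#|A|%:R / #|G|%:R : R).
    apply: ltr_sum => [|w _]; last by rewrite ltNge.
    by apply/hasP; exists 0 => //; rewrite mem_index_enum.
  by rewrite conv3_sum // sumr_const -[ltRHS]mulr_natr divfK ?lt0r_neq0 // ltxx.
exists w, t; split=> //.
  by rewrite (leq_trans tK) // leq_exp2l // leq_mul2l hsD.
move=> j jL; set v := x *+ t *+ j.
have [c [hc1 hc2]] := expansion_conv3 A0 B0 C0.
set eta : R := D%:R * (L%:R * (4 / M%:R)).
have eta0 : 0 <= eta by rewrite !mulr_ge0 ?invr_ge0.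
have hv xi : large_spectrum T xi -> `|chi xi v - 1| <= eta%:C.
  move=> /hs3 hxi.
  have h1 i : i \in s -> `|chi i v - 1| <= (L%:R * (4 / M%:R))%:C.
    move=> /ht hi; rewrite (le_trans (chi_mulrn _ _ _)) //.
    rewrite rmorphM rmorph_nat ler_pM ?ler0n ?normr_ge0 // ler_nat ltnW //.
  rewrite (le_trans (inspan_chi hxi h1)) //.
  rewrite /eta [leRHS]rmorphM [in leRHS]rmorph_nat ler_wpM2r ?ler_nat //.
  by rewrite ler0c !mulr_ge0 ?invr_ge0.
have hc2' : \sum_xi `|c xi| <= (#|G|%:R / #|B|%:R : R)%:C.
  by rewrite rmorphM fmorphV !rmorph_nat.
have h1 := smooth_translate l w T0 hc1 hc2' eta0 hv.
have h2 := iter_smooth_close T0 l w inv.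
have h3 := iter_smooth_close T0 l (w + v) inv.
(* With alpha the density of [A], smoothing at both points costs [2 * l * 2e <= alpha / 4] and
   translation costs [alpha / 4]. *)
move: h1 h2 h3 hM; rewrite -/eta; set X := _ / _ * (eta + _).
rewrite !ler_norml => /andP[a1 a2] /andP[b1 b2] /andP[c1 c2] hM.
lra.
Qed.

End Fourier.

(** * The cyclic group *)

(** [X^n - 1] splits over [R[i]] and is separable, and among n distinct n-th roots of unity one is
    primitive. *)
Lemma exists_primitive_root (n : nat) : (0 < n)%nat ->
  exists z : R[i], n.-primitive_root z.
Proof.
pose p : {poly R[i]} := 'X^n - 1; have [r Dp] := closed_field_poly_normal p.
move=> n0; rewrite (monicP _) ?monicXnsubC // scale1r in Dp.
have rn1 : all n.-unity_root r by apply/allP=> z; rewrite -root_prod_XsubC -Dp.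
have sz_r : (n < (size r).+1)%nat.
  by rewrite -(size_prod_XsubC r (fun z => z)) -Dp size_XnsubC.
have [|z] := hasP (has_prim_root n0 rn1 _ sz_r); last by exists z.
by rewrite -separable_prod_XsubC -Dp separable_Xn_sub_1 // pnatr_eq0 -lt0n.
Qed.

(* ['Z_N] is [Z/(Zp_trunc N).+2], and [(Zp_trunc N).+2 = N] for [1 < N]. *)
Section ZnCharacters.
Variables (N : nat) (z : R[i]).
Hypothesis z_prim : (Zp_trunc N).+2.-primitive_root z.

(** The exponent multiplies representatives in [nat]; only its residue matters, as the order of [z]
    is the modulus. *)
Definition zchi (x y : 'Z_N) : R[i] := z ^+ (x * y)%nat.

Lemma zchiC x y : zchi x y = zchi y x.
Proof. by rewrite /zchi mulnC. Qed.

Lemma zchiDr x y w : zchi x (y + w) = zchi x y * zchi x w.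
Proof.
rewrite /zchi -exprD -mulnDr -(prim_expr_mod z_prim) -[in RHS](prim_expr_mod z_prim).
by rewrite modnMmr.
Qed.

Lemma zchiDl x y w : zchi (x + y) w = zchi x w * zchi y w.
Proof. by rewrite ![zchi _ w]zchiC zchiDr. Qed.

Lemma zchi_norm x y : `|zchi x y| = 1.
Proof.
rewrite /zchi normrX.
have : `|z| ^+ (Zp_trunc N).+2 = 1 by rewrite -normrX (prim_expr_order z_prim) normr1.
by move/eqP; rewrite pexpr_eq1 // => /eqP ->; rewrite expr1n.
Qed.

Lemma zchi_sumr x : \sum_y zchi x y = (#|'Z_N| * (x == 0))%:R.
Proof.
have [->|x0] := eqVneq x 0.
  under eq_bigr do rewrite /zchi mul0n expr0.
  by rewrite sumr_const muln1.
rewrite muln0; set S := \sum_y _.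
have h : S = zchi x 1 * S.
  rewrite {1}/S (reindex_inj (addrI 1)) /= mulr_sumr.
  by apply: eq_bigr => y _; rewrite zchiDr.
have h1 : zchi x 1 != 1.
  rewrite /zchi -(prim_order_dvd z_prim) muln1 gtnNdvd ?ltn_ord // lt0n.
  by apply: contra x0 => /eqP e; apply/eqP/val_inj.
have : (1 - zchi x 1) * S = 0 by rewrite mulrBl mul1r -h subrr.
by move/eqP; rewrite mulf_eq0 subr_eq0 eq_sym (negbTE h1) /= => /eqP.
Qed.

Lemma zchi_suml y : \sum_x zchi x y = (#|'Z_N| * (y == 0))%:R.
Proof. by rewrite -zchi_sumr; apply: eq_bigr => x _; rewrite zchiC. Qed.
End ZnCharacters.

(** Given [b] and [c], the element of [A] is forced to be [w - c - b]. *)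
Lemma rep_count_conv3 N (A B C : {set 'Z_N}) w : B != set0 -> C != set0 ->
  (rep_count A B C w)%:R = conv3 A B C w * #|B|%:R * #|C|%:R.
Proof.
move=> B0 C0.
have nB : (#|B|%:R : R) != 0 by rewrite pnatr_eq0 cards_eq0.
have nC : (#|C|%:R : R) != 0 by rewrite pnatr_eq0 cards_eq0.
rewrite /conv3 /conv2 -mulr_suml mulrAC !divfK //.
pose F (a b c : 'Z_N) : R := [&& a \in A, b \in B, c \in C & a + b + c == w]%:R.
have -> : (rep_count A B C w)%:R = \sum_a \sum_b \sum_c F a b c.
  rewrite pair_bigA pair_bigA /= /rep_count -sum1dep_card natr_sum big_mkcond.
  by apply: eq_bigr => -[[a b] c] _; rewrite /F /=; case: ifP.
under eq_bigr do rewrite exchange_big /=.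
rewrite exchange_big /= [RHS]big_mkcond; apply: eq_bigr => c _.
rewrite exchange_big /=; case: (boolP (c \in C)) => cC; last first.
  by rewrite big1 // => b _; rewrite big1 // => a _; rewrite /F (negbTE cC) /= !andbF.
rewrite [RHS]big_mkcond; apply: eq_bigr => b _.
case: (boolP (b \in B)) => bB; last first.
  by rewrite big1 // => a _; rewrite /F (negbTE bB) /= andbF.
rewrite (bigD1 (w - c - b)) //= big1 ?addr0.
  by rewrite /F bB cC /= !subrK eqxx andbT.
move=> a ha; rewrite /F; case: eqP => [e|]; last by rewrite !andbF.
by case/eqP: ha; rewrite -e !addrK.
Qed.

Lemma long_progression (N : nat) (A B C : {set 'Z_N}) (k l M L D : nat) (e : R) :
    (1 < N)%nat -> A != set0 -> B != set0 -> C != set0 ->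
    (0 < k)%nat -> 0 < e <= 2 -> (0 < M)%nat ->
    4 * N%:R / #|C|%:R <= exp (k%:R * e ^+ 2 / 8) ->
    2 * (N%:R / #|B|%:R) ^+ k <= exp (D%:R / 32) ->
    l%:R * e * 16 <= #|A|%:R / N%:R ->
    N%:R / #|B|%:R * (D%:R * (L%:R * (4 / M%:R)) + 2 * (1 / 4) ^+ l) * 4
      <= #|A|%:R / N%:R :> R ->
    (L * expn M.+1 (2 * D) <= N)%nat ->
  exists a d : 'Z_N,
    (forall i j : nat, (i < L)%nat -> (j < L)%nat ->
       ap_term a d i = ap_term a d j -> i = j) /\
    forall i : nat, (i < L)%nat ->
      ap_term a d i \in sumset3 A B C /\
      #|A|%:R * #|B|%:R * #|C|%:R / N%:R / 2 <= (rep_count A B C (ap_term a d i))%:R :> R.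
Proof.
move=> N1 A0 B0 C0 k0 he M0 hk hD hl hM hN.
have cN : #|'Z_N| = N by rewrite card_ord Zp_cast.
have [z hz] := @exists_primitive_root (Zp_trunc N).+2 isT.
have := @conv3_progression _ (@zchi N z) (zchiDl hz) (zchiDr hz) (zchi_norm hz)
  (zchi_suml hz) (zchi_sumr hz) A B C 1 k l M L D e A0 B0 C0 k0 he M0.
rewrite cN => /(_ hk hD hl hM) [a [t [t0 tK ht]]].
have nA : (0 < #|A|%:R :> R) by rewrite ltr0n card_gt0.
have nB : (0 < #|B|%:R :> R) by rewrite ltr0n card_gt0.
have nC : (0 < #|C|%:R :> R) by rewrite ltr0n card_gt0.
have nN : (0 < N%:R :> R) by rewrite ltr0n ltnW.
exists a, (1 *+ t); split.
  (* No wraparound: [t * i < t * L <= N], so distinct indices give distinct residues. *)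
  have key i : (i < L)%nat -> (t * i < N)%nat.
    move=> iL; apply: leq_trans hN.
    apply: (@leq_trans (t * L)%nat); first by rewrite ltn_pmul2l.
    by rewrite mulnC leq_mul2l tK orbT.
  move=> i j iL jL; rewrite /ap_term => /addrI.
  rewrite -!mulrnA => /(congr1 (@nat_of_ord _)); rewrite !val_Zp_nat // !modn_small ?key //.
  by move/eqP; rewrite eqn_pmul2l // => /eqP.
move=> i iL; have := ht i iL; rewrite -/(ap_term a (1 *+ t) i); set w := ap_term _ _ _.
move=> hw.
have h : #|A|%:R * #|B|%:R * #|C|%:R / N%:R / 2 <= (rep_count A B C w)%:R :> R.
  rewrite rep_count_conv3 //.
  have -> : #|A|%:R * #|B|%:R * #|C|%:R / N%:R / 2 =
     #|A|%:R / N%:R / 2 * #|B|%:R * #|C|%:R :> R by field; rewrite lt0r_neq0.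
  by do 2!rewrite ler_wpM2r ?ler0n //.
split=> //.
have : 0 < (rep_count A B C w)%:R :> R.
  by apply: lt_le_trans h; rewrite !divr_gt0 // !mulr_gt0.
rewrite ltr0n => /card_gt0P[[[x y] u]]; rewrite !inE /= => /and4P[xA yB uC /eqP <-].
apply/existsP; exists x; rewrite xA; apply/existsP; exists y; rewrite yB.
by apply/existsP; exists u; rewrite uC /=.
Qed.

(** * Densities and the conclusion *)

Lemma dens_natE N (X : {set 'Z_N}) : dens X = (#|X|%:R / N%:R).
Proof. by rewrite /dens RdivE !INRE. Qed.

Arguments exp _%_R_scope.
Bind Scope R_scope with R.
Open Scope R_scope.

Lemma dens_itv N (A : {set 'Z_N}) : 1 < INR N -> A != set0 -> 0 < dens A <= 1.
Proof.
move=> hN A0; have hA : 0 < INR #|A| by apply/lt_0_INR/ssrnat.ltP; rewrite card_gt0.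
have N1 : (1 < N)%nat by apply/ssrnat.ltP/INR_lt.
split; first by apply: Rdiv_lt_0_compat => //; Lra.lra.
apply: (Rmult_le_reg_r (INR N)); first by Lra.lra.
rewrite /dens Rmult_1_l /Rdiv Rmult_assoc Rinv_l ?Rmult_1_r; last by Lra.lra.
by apply/le_INR/ssrnat.leP; rewrite (leq_trans (max_card _)) // card_ord Zp_cast.
Qed.

Theorem theorem1p4 :
  exists c : R, (0 < c) /\
  forall (N : nat) (A B C : {set 'Z_N}),
    (1 + exp (exp (exp 1)) <= INR N) ->
    A != set0 -> B != set0 -> C != set0 ->
    (dens A * Rpower (ln (2 / (dens A * dens B * dens C))) (- (5 / 2))
       >= Rpower (c * ln (INR N)) (- (1 / 2))) ->
    exists (a d : 'Z_N) (L : nat),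
      (* the L terms a, a + d, ..., a + (L-1) d are pairwise distinct *)
      (forall i j : nat, (i < L)%nat -> (j < L)%nat -> ap_term a d i = ap_term a d j -> i = j) /\
      (INR L >= Rpower (INR N)
                  (c * (dens A) ^ 2 / (ln (2 / (dens A * dens B * dens C))) ^ 4)) /\
      (forall i : nat, (i < L)%nat ->
         ap_term a d i \in sumset3 A B C /\
         (INR (rep_count A B C (ap_term a d i))
            >= / 2 * (dens A * dens B * dens C) * (INR N) ^ 2)).
Proof.
(* The constant required by [log_count_bound]. *)
exists (/ 2431000000); split; first by Lra.lra.
move=> N A B C hN A0 B0 C0 hyp.
have n1 : 1 < INR N by have := exp_pos (exp (exp 1)); Lra.lra.
have N1 : (1 < N)%nat by apply/ssrnat.ltP/INR_lt.
have [a0 a1] := @dens_itv N A n1 A0; have [b0 b1] := @dens_itv N B n1 B0.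
have [g0 g1] := @dens_itv N C n1 C0.
have [k [l [M [L [D [e [k0 [he [M0 [h1 [h2 [h3 [h4 [h5 h6]]]]]]]]]]]]]] :=
  @parameters _ _ _ _ a0 a1 b0 b1 g0 g1 n1 _ (erefl _) hyp.
have inv X Y : / (X / Y) = Y / X by rewrite /Rdiv Rinv_mult Rinv_inv Rmult_comm.
have hN' : (L * expn M.+1 (2 * D) <= N)%nat.
  rewrite -(ler_nat R) natrM natrX -!INRE -RpowE -RmultE; apply/RleP.
  exact: h5.
have hk : (0 < k)%nat by apply/ssrnat.ltP.
have hM : (0 < M)%nat by apply/ssrnat.ltP.
case: he => e0 e2.
have inE : forall X : {set 'Z_N}, / dens X = INR N / INR #|X|.
  by move=> X; rewrite /dens inv.
rewrite inE in h2 h4.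
have h1' : 4 * (INR N / INR #|C|) <= exp (INR k * e ^ 2 / 8) by rewrite -inE; exact: h1.
have [||||||a [d [ha hd]]] := @long_progression N A B C k l M L D e N1 A0 B0 C0 hk _ hM.
- by apply/andP; split; [apply/RltP | apply/RleP; move: e2; rewrite IZRposE INRE].
- apply/RleP; move: h1'; rewrite -mulrA !RpowE !IZRposE !INRE; exact.
- apply/RleP; move: h2; rewrite !RpowE !IZRposE !INRE; exact.
- apply/RleP; move: h3; rewrite dens_natE !IZRposE !INRE; exact.
- apply/RleP; move: h4; rewrite dens_natE !RpowE !IZRposE !INRE; exact.
- exact: hN'.
exists a, d, L; split; [exact: ha | split; [exact: Rle_ge | move=> i iL]].
have [w1 /RleP w2] := hd i iL; split=> //; apply: Rle_ge.
have E : / 2 * (dens A * dens B * dens C) * INR N ^ 2 =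
    INR #|A| * INR #|B| * INR #|C| / INR N / INR 2.
  by apply: product_of_densities; Lra.lra.
by rewrite E; move: w2; rewrite !INRE.
Qed.
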